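(* Let $m\ge 3$ and $n\ge 2$. For every positive integer $k$, $$\chi_{B_1(m,n)}(2k+1)=\Big[\sum_{i=0}^{m-2}(-1)^i(2k)^{(m-2)-i}\Big]\,\chi_{B_1(m,n-1)}(2k+1).$$
   Context: A signed graph $(G,\sigma)$ is a finite graph $G$ with a sign function $\sigma:E(G)\to\{+1,-1\}$; its signature is the set of negative edges. A signed coloring in $2k+1$ colors is a map $c:V(G)\to\{-k,\dots,k\}$; it is proper if $c(y)\neq\sigma(e)c(x)$ for every edge $e=xy$. The signed chromatic polynomial $\chi_{(G,\sigma)}(2k+1)$ is the number of proper signed colorings in $2k+1$ colors. For integers $m\ge 3$, $n\ge 1$, the Book graph $B(m,n)$ has vertex set $\{u,v\}\cup\{u_j^l:1\le l\le n,\,1\le j\le m-2\}$ and consists of the $n$ cycles $u\,u_1^l\cdots u_{m-2}^l\,v\,u$ sharing the edge $uv$. For $1\le l\le n$, $B_l(m,n)$ denotes $B(m,n)$ with signature $\{uu_1^1,uu_1^2,\dots,uu_1^l\}$. *)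

(* Defs.v *)
From mathcomp Require Import all_boot all_order all_algebra.

Set Implicit Arguments.
Unset Strict Implicit.
Unset Printing Implicit Defensive.

Import Order.TTheory GRing.Theory Num.Theory.
Local Open Scope ring_scope.

Record graph := Graph {
  vertex : finType;
  edges : {set {set vertex}};
  edges_card2 : forall e, e \in edges -> #|e| = 2%N }.

(* Values of [sign] outside [edges] are irrelevant. *)
Record signed_graph := SignedGraph {
  under :> graph;
  sign : {set vertex under} -> int;
  signP : forall e, e \in edges under -> sign e = 1 \/ sign e = -1 }.

Definition signature (S : signed_graph) : {set {set vertex S}} :=
  [set e in edges S | sign e == -1].

Lemma signed_byP (G : graph) (N : {set {set vertex G}}) e :
  e \in edges G ->
  (if e \in N then -1 else 1 : int) = 1 \/
  (if e \in N then -1 else 1 : int) = -1.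
Proof. by case: ifP; [right | left]. Qed.

Definition signed_by (G : graph) (N : {set {set vertex G}}) : signed_graph :=
  SignedGraph (@signed_byP G N).

Lemma signature_signed_by (G : graph) (N : {set {set vertex G}}) :
  N \subset edges G -> signature (signed_by N) = N.
Proof.
move=> /subsetP sNE; apply/setP=> e; rewrite inE /=.
by case: ifP => [/sNE ->|_]; rewrite ?eqxx ?andbF.
Qed.

(* The 2k+1 colors -k, ..., k are indexed by 'I_(2k+1) through i |-> i - k. *)
Definition color (k : nat) (i : 'I_(2 * k + 1)) : int := i%:Z - k%:Z.

Lemma color_inj k : injective (@color k).
Proof. by move=> i j /addIr [] /val_inj. Qed.

Lemma colorP k (a : int) :
  reflect (exists i : 'I_(2 * k + 1), color i = a) (- k%:Z <= a <= k%:Z).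
Proof.
apply: (iffP andP) => [[h1 h2]|[i <-]]; last first.
  rewrite /color lerBrDr addNr lerBlDr -PoszD !lez_nat; split=> //.
  by case: i => i /=; rewrite addn1 ltnS mul2n -addnn.
have h : 0 <= a + k%:Z by rewrite -lerBlDr sub0r.
have lt_i : (`|(a + k%:Z)%R| < 2 * k + 1)%N.
  by rewrite addn1 ltnS -lez_nat gez0_abs // mul2n -addnn PoszD lerD2r.
by exists (Ordinal lt_i); rewrite /color /= gez0_abs // addrK.
Qed.

Definition proper (S : signed_graph) (k : nat)
    (c : {ffun vertex S -> 'I_(2 * k + 1)}) : bool :=
  [forall x, forall y, ([set x; y] \in edges S) ==>
     (color (c y) != sign [set x; y] * color (c x))].

(* [signed_chrom S k] is the value at 2k+1 of the signed chromatic
   polynomial of S. *)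
Definition signed_chrom (S : signed_graph) (k : nat) : nat :=
  #|[set c : {ffun vertex S -> 'I_(2 * k + 1)} | proper c]|.

Section Book.
Variables m n : nat.

(* [inl false] is u, [inl true] is v, and [inr (l, j)] is u_(j+1)^(l+1). *)
Definition book_vertex : finType := (bool + 'I_n * 'I_(m - 2))%type.

Definition book_u : book_vertex := inl false.
Definition book_v : book_vertex := inl true.

(* The path u = w_0, w_1 = u_1^l, ..., w_(m-2) = u_(m-2)^l, w_(m-1) = v. *)
Definition page_vertex (l : 'I_n) (i : nat) : book_vertex :=
  if i is j.+1 then
    if insub j is Some j' then inr (l, j') else book_v
  else book_u.

Definition page_edge (l : 'I_n) (i : nat) : {set book_vertex} :=
  [set page_vertex l i; page_vertex l i.+1].

Definition book_edges : {set {set book_vertex}} :=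
  [set book_u; book_v] |: [set page_edge l i | l : 'I_n, i : 'I_(m - 1)].

Lemma book_edges_card2 e : e \in book_edges -> #|e| = 2%N.
Proof.
case/setU1P=> [->|/imset2P[l i _ _ ->]]; rewrite cards2 //.
congr _.+1; apply/eqP; rewrite eqb1 /page_vertex.
case: i => -[|i] /= lt_i; first by case: insubP.
have lt_i2 : (i < m - 2)%N by move: lt_i; rewrite !ltn_subRL.
rewrite insubT; case: insubP => [j _ Ej|_] //.
apply/eqP=> -[Eij]; move: Ej; rewrite -Eij /= => /eqP.
by rewrite -[X in X == _]addn0 -addn1 eqn_add2l.
Qed.

Definition book : graph := Graph book_edges_card2.

(* B_l(m,n): the edges u u_1^1, ..., u u_1^l are negative. *)
Definition signed_book (l : nat) : signed_graph :=
  signed_by (G := book) [set page_edge j 0 | j : 'I_n & (j < l)%N].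

End Book.

Lemma signature_signed_book m n l : (3 <= m)%N ->
  signature (signed_book m n l) =
    [set page_edge m j 0 | j : 'I_n & (j < l)%N].
Proof.
move=> m3; apply: signature_signed_by; apply/subsetP=> e /imsetP[j _ ->].
have m1 : (0 < m - 1)%N by rewrite subn_gt0 (ltn_trans _ m3).
by apply/setU1P; right; apply/imset2P; exists j (Ordinal m1).
Qed.

(* Main.v *)
Require Import Defs.
From mathcomp Require Import all_boot all_order all_algebra.

Set Implicit Arguments.
Unset Strict Implicit.
Unset Printing Implicit Defensive.

Import Order.TTheory GRing.Theory Num.Theory.
Local Open Scope ring_scope.

(** A proper coloring of B_1(m,n) is a proper coloring of B_1(m,n-1) together
    with a coloring of the last page, all of whose edges are positive.  In that
    page one counts the walks with m-2 inner vertices between the distinct colors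
    of u and v in which consecutive colors differ.  Deleting the condition on
    the first edge leaves (2k)^(m-2) walks, and those violating it are walks with
    one inner vertex less; so the counts f_p for p inner vertices satisfy
    f_(p+1) = (2k)^(p+1) - f_p, as does the alternating sum. *)

Section Walks.
Variable C : finType.

(** Walks from [a] to [b] with [p] inner vertices in the complete graph on [C], split by the first
    inner vertex. *)
Fixpoint walks (p : nat) (a b : C) : nat :=
  if p is p'.+1 then (\sum_(x | x != a) walks p' x b)%N else (a != b).

Lemma card_walks p a b :
  #|[set t : p.-tuple C | path (fun x y => x != y) a (rcons t b)]|
  = walks p a b.
Proof.
elim: p a => [|p IHp] a /=.
  rewrite -sum1_card (eq_bigl (fun=> a != b)) => [|t]; last first.
    by rewrite inE tuple0 /= andbT.
  by rewrite big_mkcond sum_nat_const card_tuple expn0 mul1n; case: (a != b).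
rewrite -sum1_card (reindex (fun xt : C * p.-tuple C => [tuple of xt.1 :: xt.2])).
  rewrite (eq_bigl (fun xt : C * p.-tuple C => (xt.1 != a) &&
    (xt.2 \in [set t : p.-tuple C | path (fun x y => x != y) xt.1 (rcons t b)]))).
    rewrite -(pair_big_dep (fun x => x != a) (fun x (t : p.-tuple C) =>
      t \in [set t : p.-tuple C | path (fun x y => x != y) x (rcons t b)])
      (fun _ _ => 1%N)).
    by apply: eq_bigr => x _; rewrite sum1_card IHp.
  by move=> [x t]; rewrite !inE /= [a == x]eq_sym.
exists (fun t : p.+1.-tuple C => (thead t, [tuple of behead t])) => [[x t]|t] _.
  by congr (_, _); apply: val_inj.
by rewrite /= -tuple_eta.
Qed.

(** Read backwards from [b], each of the [p.+1] earlier vertices, the free start included, only has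
    to avoid its successor. *)
Lemma sum_walks p b : (\sum_a walks p a b = #|C|.-1 ^ p.+1)%N.
Proof.
elim: p => [|p IHp] /=.
  rewrite (bigD1 b) //= eqxx add0n expn1 (eq_bigr (fun=> 1%N)) => [|a ->//].
  by rewrite sum1_card cardC1.
rewrite (exchange_big_dep predT) //= expnS -IHp big_distrr /=.
apply: eq_bigr => x _; rewrite sum_nat_const -(cardC1 x); congr (_ * _)%N.
by apply: eq_card => y; rewrite !inE eq_sym.
Qed.

Lemma walks_neq p a b : a != b ->
  (walks p a b)%:Z = \sum_(0 <= i < p.+1) (-1) ^+ i * #|C|.-1%:Z ^+ (p - i).
Proof.
move=> neq_ab; elim: p => [|p IHp].
  by rewrite /= neq_ab big_nat1 expr0 mul1r.
rewrite big_nat_recl // expr0 mul1r subn0.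
(* The first inner vertex takes every value except [a], so the sum is that of [sum_walks] without
   its term at [a]. *)
have -> : (walks p.+1 a b)%:Z = #|C|.-1%:Z ^+ p.+1 - (walks p a b)%:Z.
  rewrite -(natz #|C|.-1) -natrX natz -(sum_walks p b) (bigD1 a) //= PoszD.
  by rewrite addrC addKr.
rewrite IHp -sumrN; congr (_ + _); apply: eq_bigr => i _.
by rewrite subSS exprS mulN1r mulNr.
Qed.

End Walks.

Section BookEdges.
Variables (m n : nat).
Hypothesis hm : (3 <= m)%N.

Lemma page_vertex_inner (l : 'I_n) (j : 'I_(m - 2)) :
  page_vertex m l j.+1 = inr (l, j).
Proof. by rewrite /page_vertex valK. Qed.

Lemma page_vertex_eq_u (l : 'I_n) i : (page_vertex m l i == book_u m n) = (i == 0%N).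
Proof. by case: i => [|i] //=; case: insubP. Qed.

(** On a page, [book_u] occurs only at index 0, which forces [i = 0]. The other end is an inner
    vertex, as [m >= 3], and so determines the page. *)
Lemma page_edge_first (l j : 'I_n) i :
  (page_edge m l i == page_edge m j 0) = (i == 0%N) && (l == j).
Proof.
apply/eqP/andP=> [E|[/eqP-> /eqP->] //].
have i0 : i = 0%N.
  have: book_u m n \in page_edge m l i by rewrite E set21.
  by rewrite in_set2 !(eq_sym (book_u m n)) !page_vertex_eq_u orbF => /eqP.
split; first by rewrite i0.
have lt0 : (0 < m - 2)%N by rewrite subn_gt0.
have: page_vertex m j 1 \in page_edge m l i by rewrite E set22.
rewrite i0 in_set2 -[1%N]/((Ordinal lt0).+1) !page_vertex_inner.
by case/orP=> /eqP // [->].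
Qed.

Lemma sign_page_edge l (j : 'I_n) i :
  sign (s := signed_book m n l) (page_edge m j i)
  = if (i == 0%N) && (j < l)%N then -1 else 1.
Proof.
rewrite /=; congr (if _ then _ else _); apply/imsetP/andP=> [[j' j'l /eqP]|].
  by rewrite page_edge_first => /andP[-> /eqP->]; rewrite inE in j'l.
by move=> [/eqP-> jl]; exists j; rewrite ?inE.
Qed.

Lemma sign_spine l :
  sign (s := signed_book m n l) [set book_u m n; book_v m n] = 1.
Proof.
rewrite /=; case: ifP => // /imsetP[j _ E].
have lt0 : (0 < m - 2)%N by rewrite subn_gt0.
(* A negative edge contains the first inner vertex of its page, which is neither [book_u] nor
   [book_v]. *)
have: page_vertex m j 1 \in [set book_u m n; book_v m n] by rewrite E set22.
by rewrite in_set2 -[1%N]/((Ordinal lt0).+1) page_vertex_inner.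
Qed.

(** Replaces the condition on unordered edges by one inequality for each step along a page from
    [book_u] to [book_v], plus one for the positive edge uv. *)
Lemma proper_bookP l k (c : {ffun vertex (signed_book m n l) -> 'I_(2 * k + 1)}) :
  reflect (c (book_u m n) != c (book_v m n) /\
     forall (j : 'I_n) i, (i < m - 1)%N ->
       color (c (page_vertex m j i.+1)) !=
       (if (i == 0%N) && (j < l)%N then -1 else 1) * color (c (page_vertex m j i)))
    (Defs.proper c).
Proof.
apply: (iffP idP) => [/forallP c_proper|[c_uv c_page]].
  have edgeP x y : [set x; y] \in edges (signed_book m n l) ->
      color (c y) != sign [set x; y] * color (c x).
    by move/forallP/(_ y)/implyP: (c_proper x); apply.
  split=> [|j i lt_i].
    have := edgeP (book_u m n) (book_v m n) (setU11 _ _).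
    by rewrite sign_spine mul1r eq_sym (inj_eq (@color_inj k)).
  rewrite -sign_page_edge; apply: edgeP; apply/setU1P; right.
  by apply/imset2P; exists j (Ordinal lt_i).
(* A sign is its own inverse, so the condition on an edge does not depend on its orientation; [good]
   uses this because equal edges determine their ends only up to order. *)
have flip (s a b : int) : s = 1 \/ s = -1 -> (b != s * a) = (a != s * b).
  by case=> ->; rewrite ?mul1r ?mulN1r 1?eq_sym // eqr_oppLR.
suff good (x y x' y' : vertex (signed_book m n l)) :
    [set x; y] = [set x'; y'] -> [set x; y] \in edges (signed_book m n l) ->
    color (c y') != sign [set x'; y'] * color (c x') ->
    color (c y) != sign [set x; y] * color (c x).
  apply/forallP=> x; apply/forallP=> y; apply/implyP=> xyE.
  case/setU1P: (xyE) => [E|/imset2P[j i _ _ E]]; apply: (good _ _ _ _ E xyE).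
    by rewrite sign_spine mul1r (inj_eq (@color_inj k)) eq_sym.
  by rewrite sign_page_edge; apply: c_page.
move=> E xyE; rewrite -E.
have [Ex Ey] : x \in [set x'; y'] /\ y \in [set x'; y'].
  by rewrite -E set21 set22.
have neq_xy : x != y by move: (edges_card2 xyE); rewrite cards2; case: (x != y).
move: Ex Ey neq_xy; rewrite !in_set2.
case/orP=> /eqP-> /orP[]/eqP->; rewrite ?eqxx // => _.
by rewrite flip //; move: xyE; rewrite E; rewrite setUC; apply: signP.
Qed.

End BookEdges.

Section LastPage.
Variables (m n k : nat).
Hypotheses (hm : (3 <= m)%N) (hn : (0 < n)%N).
Local Notation col := 'I_(2 * k + 1).
Local Notation coloring n := {ffun book_vertex m n -> col}.

(** The new page is the last one, [ord_max]: lifting then keeps the index of each old page, hence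
    also the signs of its edges. *)
Definition add_page (cd : coloring n * (m - 2).-tuple col) : coloring n.+1 :=
  [ffun x => match x with
             | inl b => cd.1 (inl b)
             | inr (l, j) => if unlift ord_max l is Some l'
                             then cd.1 (inr (l', j)) else tnth cd.2 j
             end].

Definition drop_page (c : coloring n.+1) : coloring n :=
  [ffun x => match x with
             | inl b => c (inl b)
             | inr (l, j) => c (inr (lift ord_max l, j))
             end].

Lemma add_page_bij : bijective add_page.
Proof.
exists (fun c => (drop_page c, [tuple c (inr (ord_max, j)) | j < m - 2]))
  => [[c d]|c].
  congr (_, _).
    by apply/ffunP=> -[b|[l j]]; rewrite !ffunE //= liftK.
  by apply: eq_from_tnth => j; rewrite tnth_mktuple ffunE unlift_none.
apply/ffunP=> -[b|[l j]]; rewrite !ffunE //=.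
by case: unliftP => [l'|] ->; rewrite ?ffunE // tnth_mktuple.
Qed.

Lemma add_page_old c d (l : 'I_n) i :
  add_page (c, d) (page_vertex m (lift ord_max l) i) = c (page_vertex m l i).
Proof.
by case: i => [|i]; rewrite ffunE //=; case: insubP => *; rewrite ?liftK.
Qed.

Lemma add_page_new c d i : (i <= m - 1)%N ->
  add_page (c, d) (page_vertex m ord_max i)
  = nth (c (book_v m n)) (c (book_u m n) :: rcons d (c (book_v m n))) i.
Proof.
case: i => [|i] le_i; first by rewrite /= ffunE.
rewrite /= nth_rcons size_tuple; case: insubP => [j _ <-|].
  by rewrite ffunE unlift_none /= ltn_ord (tnth_nth (c (book_v m n))).
(* Beyond the inner vertices the page is at [book_v], whose color is both the last entry of the
   sequence and the default of [nth]. *)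
by move/negbTE->; rewrite ffunE if_same.
Qed.

Lemma proper_add_page c d :
  Defs.proper (S := signed_book m n.+1 1) (add_page (c, d)) =
  Defs.proper (S := signed_book m n 1) c &&
  path (fun x y => x != y) (c (book_u m n)) (rcons d (c (book_v m n))).
Proof.
have m1 : (m - 1 = (m - 2).+1)%N by rewrite -subSn // ltnW.
(* Since [n > 0], the last page is not page 0, which carries the only negative edge. *)
have new_positive : (@ord_max n < 1)%N = false by rewrite ltnS leqn0 gtn_eqF.
apply/proper_bookP/andP=> // [[c_uv c_page]|[/proper_bookP[]// c_uv c_page]].
  split.
    apply/proper_bookP => //; split=> [|j i lt_i].
      by move: c_uv; rewrite !ffunE.
    by have := c_page (lift ord_max j) i lt_i; rewrite !add_page_old lift_max.
  apply/(pathP (c (book_v m n))) => i; rewrite size_rcons size_tuple -m1 => lt_i.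
  have := c_page ord_max i lt_i; rewrite !add_page_new ?(ltnW lt_i) //.
  by rewrite new_positive andbF mul1r (inj_eq (@color_inj k)) eq_sym.
move/(pathP (c (book_v m n))); rewrite size_rcons size_tuple -m1 => d_path.
split=> [|j i lt_i]; first by rewrite !ffunE.
case: (unliftP ord_max j) => [j'|] ->.
  by rewrite !add_page_old lift_max; apply: c_page.
rewrite !add_page_new ?(ltnW lt_i) //.
rewrite new_positive andbF mul1r (inj_eq (@color_inj k)) eq_sym.
exact: d_path.
Qed.

Lemma signed_chrom_add_page :
  (signed_chrom (signed_book m n.+1 1) k =
   \sum_(c : coloring n | Defs.proper (S := signed_book m n 1) c)
      walks (m - 2) (c (book_u m n)) (c (book_v m n)))%N.
Proof.
rewrite /signed_chrom -sum1_card (reindex add_page) /=; last first.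
  by apply: onW_bij; apply: add_page_bij.
rewrite (eq_bigl (fun cd : coloring n * (m - 2).-tuple col =>
  Defs.proper (S := signed_book m n 1) cd.1 &&
  (cd.2 \in [set t : (m - 2).-tuple col |
     path (fun x y => x != y) (cd.1 (book_u m n)) (rcons t (cd.1 (book_v m n)))]))).
  rewrite -(pair_big_dep (fun c => Defs.proper (S := signed_book m n 1) c)
    (fun c t => t \in [set t : (m - 2).-tuple col |
       path (fun x y => x != y) (c (book_u m n)) (rcons t (c (book_v m n)))])
    (fun _ _ => 1%N)).
  by apply: eq_bigr => c _; rewrite sum1_card card_walks.
by move=> [c d]; rewrite !inE proper_add_page.
Qed.

End LastPage.

Theorem theorem6p7 (m n : nat) (hm : (3 <= m)%N) (hn : (2 <= n)%N)
    (k : nat) (hk : (0 < k)%N) :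
  (signed_chrom (signed_book m n 1) k)%:Z =
    (\sum_(0 <= i < (m - 2).+1) (-1) ^+ i * (2 * k)%:Z ^+ ((m - 2) - i))
    * (signed_chrom (signed_book m (n - 1) 1) k)%:Z.
Proof.
case: n hn => [|n] // hn; rewrite subn1 /= signed_chrom_add_page //.
rewrite -[LHS]natz natr_sum /=.
(* The positive edge uv makes the end colors distinct, so each proper coloring contributes the same
   alternating sum, with [#|C|.-1 = 2 * k]. *)
under eq_bigr => c /(proper_bookP hm)[c_uv _].
  rewrite natz (walks_neq _ c_uv) card_ord addn1 /=; over.
by rewrite sumr_const -mulr_natr natz /signed_chrom cardsE.
Qed.
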